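(* Let $E$ be a Banach space, $p\in(1,2)$ and $\alpha\in(0,\frac1p-\frac12)$. If $C^\alpha([0,1];E)\hookrightarrow\gamma((0,1);E)$ (i.e. every $\alpha$-Hölder continuous $f:[0,1]\to E$ belongs to $\gamma((0,1);E)$ and the inclusion is continuous), then $E$ has type $p$.
   Context: $C^\alpha([0,1];E)$ is the space of $f:[0,1]\to E$ with $\|f\|_{C^\alpha}=\sup_t\|f(t)\|+\sup_{s<t}\|f(t)-f(s)\|/|t-s|^\alpha<\infty$. $\gamma((0,1);E)$ is the space of strongly measurable $f:(0,1)\to E$ with $\langle f,x^*\rangle\in L^2(0,1)$ for all $x^*\in E^*$ such that $I_f:L^2(0,1)\to E$, $I_fg=\int_0^1fg\,dt$, belongs to $\gamma(L^2(0,1),E)$, normed by $\|I_f\|_{\gamma(L^2(0,1),E)}$; here $\gamma(H,E)$ is the completion of finite rank operators $Rh=\sum_{n=1}^N[h,h_n]x_n$ ($h_n$ orthonormal) in the norm $(\mathbb E\|\sum\gamma_nRh_n\|^2)^{1/2}$, $(\gamma_n)$ i.i.d. standard Gaussians. $E$ has type $p$ if there is $C$ with $(\mathbb E\|\sum r_nx_n\|^2)^{1/2}\le C(\sum\|x_n\|^p)^{1/p}$ for all finite sequences in $E$, $(r_n)$ Rademacher. *)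

(* Defs.v *)
From HB Require Import structures.
From mathcomp Require Import all_boot all_order all_algebra.
From mathcomp Require Import all_classical all_reals all_analysis.
Set Implicit Arguments. Unset Strict Implicit. Unset Printing Implicit Defensive.
Import Order.TTheory GRing.Theory Num.Theory.
Import numFieldNormedType.Exports.
Local Open Scope classical_set_scope.
Local Open Scope ring_scope.

Definition L2 {R : realType} (g : R -> R) : Prop :=
  measurable_fun `](0:R)%R, (1:R)%R[%classic g /\
  (\int[@lebesgue_measure R]_(t in `](0:R)%R, (1:R)%R[%classic) ((g t) ^+ 2)%:E < +oo)%E.

Definition ip {R : realType} (g h : R -> R) : R :=
  Rintegral (@lebesgue_measure R) `](0:R)%R, (1:R)%R[%classic (fun t => g t * h t).

Definition orthonormal {R : realType} (M : nat) (e : 'I_M -> R -> R) : Prop :=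
  (forall i, L2 (e i)) /\ (forall i j, ip (e i) (e j) = (i == j)%:R).

(* ---------- Gaussian expectation of a function of N i.i.d. standard
   Gaussians v 0, ..., v (N-1) (iterated integrals against the N(0,1) density) *)
Fixpoint gexp {R : realType} (N : nat) (F : (nat -> R) -> \bar R) : \bar R :=
  match N with
  | 0 => F (fun _ => 0)
  | S N' => (\int[@lebesgue_measure R]_t
              ((normal_pdf 0 1 t)%:E *
               gexp N' (fun v => F (fun n => if n is S m then v m else t)))%E)
  end.

Definition gauss_sq {R : realType} {E : normedModType R} (M : nat) (y : 'I_M -> E)
  : \bar R :=
  gexp M (fun v => (`| \sum_(i < M) v i *: y i | ^+ 2)%:E).

Definition rad_sq {R : realType} {E : normedModType R} (N : nat) (x : 'I_N -> E) : R :=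
  (2 ^+ N)^-1 * \sum_(s : {ffun 'I_N -> bool})
     `| \sum_(i < N) (if s i then 1 else -1) *: x i | ^+ 2.

Definition has_type {R : realType} (E : normedModType R) (p : R) : Prop :=
  exists C : R, forall (N : nat) (x : 'I_N -> E),
    Num.sqrt (rad_sq x) <= C * (\sum_(i < N) `|x i| `^ p) `^ p^-1.

(* ---------- finite rank operators  R h = sum_n [h, h_n] x_n ---------- *)
Record frank (R : realType) (E : normedModType R) := FRank {
  frN : nat; frh : 'I_frN -> R -> R; frx : 'I_frN -> E }.
Arguments frN {R E} f.
Arguments frh {R E} f _.
Arguments frx {R E} f _.

Definition fr_ok {R : realType} {E : normedModType R} (r : frank E) : Prop :=
  forall i, L2 (frh r i).

Definition fr_app {R : realType} {E : normedModType R} (r : frank E) (g : R -> R) : E :=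
  \sum_(i < frN r) ip g (frh r i) *: frx r i.

(* squared gamma-norm of a finite rank operator T : L^2(0,1) -> E:
   E||sum_n gamma_n T h_n||^2 for an orthonormal system (h_n) with
   T h = sum_n [h,h_n] T h_n for all h in L^2 (independent of the choice) *)
Definition gamma_sq {R : realType} {E : normedModType R} (T : (R -> R) -> E) : \bar R :=
  ereal_sup [set z | exists (M : nat) (e : 'I_M -> R -> R),
     [/\ orthonormal e,
         (forall g, L2 g -> T g = \sum_(i < M) ip g (e i) *: T (e i)) &
         z = gauss_sq (fun i => T (e i))]].

Definition linfun {R : realType} {E : normedModType R} (phi : E -> R) : Prop :=
  forall (a : R) (x y : E), phi (a *: x + y) = a * phi x + phi y.

(* operator norm of I_f - T, computed weakly:
   sup over ||g||_2 <= 1, ||x*|| <= 1 of |<I_f g - T g, x*>|,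
   where <I_f g, x*> = int_0^1 <f t, x*> g t dt *)
Definition opdist {R : realType} {E : normedModType R}
    (f : R -> E) (T : (R -> R) -> E) : \bar R :=
  ereal_sup [set z | exists (phi : E -> R) (g : R -> R),
     [/\ linfun phi, (forall x, `|phi x| <= `|x|), L2 g,
         (\int[@lebesgue_measure R]_(t in `](0:R)%R, (1:R)%R[%classic) ((g t) ^+ 2)%:E <= 1)%E &
         z = (`| Rintegral (@lebesgue_measure R) `](0:R)%R, (1:R)%R[%classic (fun t => phi (f t) * g t)
                 - phi (T g) |)%:E]].

Record simplefun (R : realType) (E : normedModType R) := SFun {
  sfN : nat; sfA : 'I_sfN -> set R; sfx : 'I_sfN -> E }.
Arguments sfN {R E} s.
Arguments sfA {R E} s _.
Arguments sfx {R E} s _.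

Definition sf_app {R : realType} {E : normedModType R} (s : simplefun E) (t : R) : E :=
  \sum_(j < sfN s) \1_(sfA s j) t *: sfx s j.

Definition strongly_measurable {R : realType} {E : normedModType R} (f : R -> E) : Prop :=
  exists s : nat -> simplefun E,
    (forall k j, measurable (sfA (s k) j)) /\
    {ae @lebesgue_measure R, forall t, `](0:R)%R, (1:R)%R[%classic t -> sf_app (s k) t @[k --> \oo] --> f t}.

(* I_f belongs to gamma(L^2(0,1),E) (the completion of the finite rank operators
   in the gamma-norm, realised inside L(L^2,E)) with gamma-norm c *)
Definition gamma_norm_is {R : realType} {E : normedModType R} (f : R -> E) (c : R) : Prop :=
  0 <= c /\
  exists r : nat -> frank E,
    [/\ (forall k, fr_ok (r k)),
        opdist f (fr_app (r k)) @[k --> \oo] --> 0%E,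
        (forall e : R, 0 < e -> exists K : nat, forall k l : nat, (K <= k)%N -> (K <= l)%N ->
           (gamma_sq (fun g => (fr_app (r k) g - fr_app (r l) g)%R) <= e%:E)%E) &
        gamma_sq (fr_app (r k)) @[k --> \oo] --> (c ^+ 2)%:E].

Definition in_gamma {R : realType} {E : normedModType R} (f : R -> E) : Prop :=
  [/\ strongly_measurable f,
      (forall phi : E -> R, linfun phi -> continuous phi -> L2 (fun t => phi (f t))) &
      exists c, gamma_norm_is f c].

Definition holder_norm {R : realType} {E : normedModType R} (alpha : R) (f : R -> E) : \bar R :=
  (ereal_sup [set (`|f t|)%:E | t in `[(0:R)%R, (1:R)%R]%classic] +
   ereal_sup [set z | exists s t, [/\ `[(0:R)%R, (1:R)%R]%classic s, `[(0:R)%R, (1:R)%R]%classic t, (s < t)%R &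
                 z = (`|f t - f s| / (t - s) `^ alpha)%R%:E]])%E.

(* Main.v *)
Require Import Defs.
From HB Require Import structures.
From mathcomp Require Import all_boot all_order all_algebra.
From mathcomp Require Import all_classical all_reals all_analysis.
From mathcomp Require Import measurable_realfun ring lra.
Import Order.TTheory GRing.Theory Num.Theory.
Import numFieldNormedType.Exports.
Local Open Scope classical_set_scope.
Local Open Scope ring_scope.

(* Given x_1, ..., x_N with S = sum |x_n|^p > 0, split (0,1) into disjoint
   intervals of length l_n >= |x_n|^p / (2S), and let e_n be the tent function on
   the n-th interval, normalized in L^2. The e_n are orthonormal, so
   f = sum_n e_n x_n has gamma-norm at least (E |sum gamma_n x_n|^2)^(1/2).
   A bump of L^2-norm 1 on an interval of length l has alpha-Hoelder norm of
   order l^(-1/2-alpha), and |x_n| <= 2 S^(1/p) l_n^(1/p) <= 2 S^(1/p)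
   l_n^(1/2+alpha); as the supports are disjoint, f has Hoelder norm of order
   S^(1/p). The embedding thus gives type p with Gaussians, and Gaussian sums
   dominate Rademacher sums by convexity. *)

(* Unlike [ge0_le_integral] this needs no measurability: the iterated integrals
   in [gexp] are of functions not known to be measurable. *)
Lemma le_integral_ge0 {d} {T : measurableType d} {R : realType}
    (mu : {measure set T -> \bar R}) (f g : T -> \bar R) :
  (forall t, (0 <= f t)%E) -> (forall t, (f t <= g t)%E) ->
  (\int[mu]_t f t <= \int[mu]_t g t)%E.
Proof.
move=> f0 fg; have g0 t : (0 <= g t)%E by apply: le_trans (fg t).
rewrite !ge0_integralTE//; apply: ereal_sup_le => _ [h hf <-].
by exists h => // t; exact: le_trans (hf t) (fg t).
Qed.

(** * Reflection invariance of Lebesgue measure *)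

Lemma measurable_oppr {R : realType} :
  measurable_fun setT (-%R : measurableTypeR R -> measurableTypeR R).
Proof. exact: oppr_measurable. Qed.

(** By uniqueness of Lebesgue measure: the reflection of an interval has the same length. *)
Lemma lebesgue_measure_oppr {R : realType} (A : set R) : measurable A ->
  @lebesgue_measure R A = pushforward (@lebesgue_measure R) (-%R : R -> R) A.
Proof.
pose nu : {measure set (measurableTypeR R) -> \bar R} :=
  measure_function_pushforward__canonical__measure_function_Measure
    (@lebesgue_measure R) measurable_oppr.
apply: (@lebesgue_measure_unique R nu) => _ [[a b] /= _ <-].
rewrite /pushforward [in RHS]opp_preimage_itvbndbnd.
rewrite !lebesgue_measure_itv/= !lte_fin ltrN2.
by case: ifP => // _; rewrite -!EFinB opprK addrC.
Qed.

Lemma ge0_integral_oppr {R : realType} (f : R -> \bar R) :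
  measurable_fun setT f -> (forall t, (0 <= f t)%E) ->
  (\int[@lebesgue_measure R]_t f t = \int[@lebesgue_measure R]_t f (- t)%R)%E.
Proof.
move=> mf f0.
rewrite (@eq_measure_integral _ _ _ setT
  (measure_function_pushforward__canonical__measure_function_Measure
    (@lebesgue_measure R) measurable_oppr)); last first.
  by move=> A mA _; exact: lebesgue_measure_oppr.
by rewrite ge0_integral_pushforward.
Qed.

Lemma integral_oppr {R : realType} (f : R -> \bar R) :
  measurable_fun setT f ->
  (\int[@lebesgue_measure R]_t f t = \int[@lebesgue_measure R]_t f (- t)%R)%E.
Proof.
move=> mf; rewrite integralE [RHS]integralE.
rewrite ge0_integral_oppr//; last exact: measurable_funepos.
rewrite [X in (_ - X)%E]ge0_integral_oppr//; last exact: measurable_funeneg.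
by congr (_ - _)%E; apply: eq_integral => t _; rewrite ?funeposE ?funenegE.
Qed.

(** * Moments of the standard Gaussian *)

Notation gpdf := (normal_pdf 0 1).

Lemma gpdfN {R : realType} (t : R) : gpdf (- t) = gpdf t.
Proof. by rewrite !normal_pdfE// /normal_fun !subr0 sqrrN. Qed.

(* Domination by the centered normal density of variance 2. *)
Lemma integrable_sqr_gpdf {R : realType} :
  (@lebesgue_measure R).-integrable setT (fun t : R => (t ^+ 2 * gpdf t)%:E).
Proof.
have s2 : Num.sqrt (2 : R) != 0 by rewrite sqrtr_eq0 -ltNge.
pose K : R := 4 * normal_peak 1 / normal_peak (Num.sqrt 2).
apply: (@le_integrable _ _ _ (@lebesgue_measure R) setT measurableT _
    (fun t => (K%:E * (normal_pdf 0 (Num.sqrt 2) t)%:E)%E)) => //.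
- apply/measurable_EFinP/measurable_funM; first exact/measurable_funX.
  exact: measurable_normal_pdf.
- move=> t _; rewrite -EFinM lee_fin ger0_norm; last first.
    by rewrite mulr_ge0 ?sqr_ge0// normal_pdf_ge0.
  apply: le_trans (ler_norm _).
  rewrite !normal_pdfE// /K.
  have P2 : normal_peak (Num.sqrt 2 : R) != 0 by rewrite gt_eqF// normal_peak_gt0.
  rewrite [leRHS](_ : _ = normal_peak 1 * (4 * normal_fun 0 (Num.sqrt 2) t)).
    rewrite mulrCA ler_wpM2l ?normal_peak_ge0//.
    rewrite /normal_fun subr0 sqr_sqrtr// expr1n.
    rewrite (_ : - t ^+ 2 / (1 *+ 2) = - (t ^+ 2 / 4) + - t ^+ 2 / (2 *+ 2)).
      rewrite expRD mulrA ler_wpM2r ?expR_ge0// expRN.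
      rewrite ler_pdivrMr ?expR_gt0//.
      have := expR_ge1Dx (t ^+ 2 / 4); nra.
    by field.
  by field.
- by apply: integrableZl => //; exact: integrable_normal_pdf.
Qed.

Lemma integrable_id_gpdf {R : realType} :
  (@lebesgue_measure R).-integrable setT (fun t : R => (t * gpdf t)%:E).
Proof.
apply: (@le_integrable _ _ _ (@lebesgue_measure R) setT measurableT _
    (fun t => (gpdf t)%:E + (t ^+ 2 * gpdf t)%:E)%E) => //.
- by apply/measurable_EFinP/measurable_funM => //; exact: measurable_normal_pdf.
- move=> t _; rewrite -EFinD lee_fin normrM.
  rewrite (ger0_norm (normal_pdf_ge0 _ _ _)).
  apply: le_trans (ler_norm _).
  rewrite -[X in X + _]mul1r -mulrDl ler_wpM2r ?normal_pdf_ge0//.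
  have := real_normK (num_real t); move: `|t| => x <-; nra.
- apply: integrableD => //; [exact: integrable_normal_pdf|].
  exact: integrable_sqr_gpdf.
Qed.

(** The integrand is odd, so the finite integral equals its own negative. *)
Lemma integral_id_gpdf {R : realType} :
  (\int[@lebesgue_measure R]_t (t * gpdf t)%:E = 0)%E.
Proof.
have mf : measurable_fun setT (fun t : R => (t * gpdf t)%:E).
  by apply/measurable_EFinP/measurable_funM => //; exact: measurable_normal_pdf.
have fin := integrable_fin_num measurableT (@integrable_id_gpdf R).
have := integral_oppr _ mf; under [X in _ = X -> _]eq_integral => t _.
  rewrite gpdfN mulNr -mulN1r EFinM; over.
rewrite integralZl//; last exact: integrable_id_gpdf.
rewrite -(fineK fin) -EFinM => -[] h; congr (_%:E).
by move: h; set x := fine _; lra.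
Qed.

(** The variance of a standard Gaussian, kept as a symbolic constant. *)
Definition gvar (R : realType) : R :=
  fine (\int[@lebesgue_measure R]_t (t ^+ 2 * gpdf t)%:E)%E.

Lemma integral_gpdf_quad {R : realType} (a b c : R) :
  (\int[@lebesgue_measure R]_t
     ((gpdf t)%:E * (a + b * t + c * t ^+ 2)%:E) = (a + c * gvar R)%:E)%E.
Proof.
have i0 := @integrable_normal_pdf R 0 1.
have i1 := @integrable_id_gpdf R.
have i2 := @integrable_sqr_gpdf R.
under eq_integral => t _.
  rewrite (_ : (_ * _)%E = (a%:E * (gpdf t)%:E + b%:E * (t * gpdf t)%:E +
     c%:E * (t ^+ 2 * gpdf t)%:E)%E); last first.
    by rewrite -!EFinM -!EFinD; congr EFin; ring.
  over.
rewrite integralD//=; last 2 first.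
- by apply: integrableD => //; exact: integrableZl.
- exact: integrableZl.
rewrite integralD//=; [|exact: integrableZl..].
rewrite !integralZl// integral_normal_pdf integral_id_gpdf mule0 mule1 adde0.
by rewrite EFinD EFinM /gvar fineK//; exact: integrable_fin_num.
Qed.

(** * Iterated Gaussian expectations *)

Lemma gexp_ge0 {R : realType} (M : nat) (F : (nat -> R) -> \bar R) :
  (forall v, (0 <= F v)%E) -> (0 <= gexp M F)%E.
Proof.
elim: M F => [|M IH] F F0 /=; first exact: F0.
by apply: integral_ge0 => t _; rewrite mule_ge0 ?lee_fin ?normal_pdf_ge0// IH.
Qed.

Lemma le_gexp {R : realType} (M : nat) (F G : (nat -> R) -> \bar R) :
  (forall v, (0 <= F v)%E) -> (forall v, (F v <= G v)%E) ->
  (gexp M F <= gexp M G)%E.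
Proof.
elim: M F G => [|M IH] F G F0 FG /=; first exact: FG.
apply: le_integral_ge0 => t.
  by rewrite mule_ge0 ?lee_fin ?normal_pdf_ge0// gexp_ge0.
by rewrite lee_pmul ?lee_fin ?normal_pdf_ge0// ?gexp_ge0// IH.
Qed.

(** Integrating out one Gaussian at a time kills the cross terms and adds a variance. The shifts
    [c n] absorb the variable that is held fixed, so that the induction hypothesis applies under the
    outer integral. *)
Lemma gexp_sum_sqr {R : realType} (M N : nat) (w c : 'I_N -> R)
    (a : 'I_N -> 'I_M -> R) :
  gexp M (fun v => (\sum_(n < N) w n * (c n + \sum_(i < M) a n i * v i) ^+ 2)%:E)
  = (\sum_(n < N) w n * (c n ^+ 2 + gvar R * \sum_(i < M) a n i ^+ 2))%:E.
Proof.
elim: M c a => [|M IH] c a /=.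
  by congr EFin; apply: eq_bigr => n _; rewrite !big_ord0 mulr0 !addr0.
under eq_integral => t _.
  rewrite (_ : (fun v : nat -> R => _) = (fun v : nat -> R =>
     (\sum_(n < N) w n * ((c n + a n ord0 * t) +
         \sum_(i < M) a n (lift ord0 i) * v i) ^+ 2)%:E)); last first.
    apply/funext => v; congr EFin; apply: eq_bigr => n _.
    by rewrite big_ord_recl addrA.
  rewrite IH (_ : \sum_(n < N) _ =
    \sum_(n < N) w n * (c n ^+ 2 + gvar R * \sum_(i < M) a n (lift ord0 i) ^+ 2)
    + (\sum_(n < N) w n * (2 * c n * a n ord0)) * t
    + (\sum_(n < N) w n * a n ord0 ^+ 2) * t ^+ 2); last first.
    rewrite !mulr_suml -!big_split/=; apply: eq_bigr => n _.
    by move: (\sum_(i < M) _) => x; ring.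
  over.
rewrite integral_gpdf_quad mulr_suml -big_split/=; congr EFin.
apply: eq_bigr => n _; rewrite big_ord_recl.
by move: (\sum_(i < M) _) => x; ring.
Qed.

(** * Gaussian sums dominate Rademacher sums *)

(* P(|gamma| >= 1) *)
Definition gtail (R : realType) : R :=
  fine (\int[@lebesgue_measure R]_t (\1_(~` `](-1 : R), 1[) t * gpdf t)%:E)%E.

Lemma integrable_gtail {R : realType} :
  (@lebesgue_measure R).-integrable setT
    (fun t : R => (\1_(~` `](-1 : R), 1[) t * gpdf t)%:E).
Proof.
apply: (@le_integrable _ _ _ (@lebesgue_measure R) setT measurableT _
    (fun t => (gpdf t)%:E)) => //.
- apply/measurable_EFinP/measurable_funM; last exact: measurable_normal_pdf.
  by apply: measurable_indic; exact: measurableC.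
- move=> t _; rewrite lee_fin normrM ler_piMl//.
  by rewrite indicE ger0_norm// lern1 leq_b1.
- exact: integrable_normal_pdf.
Qed.

Lemma gtail_le1 {R : realType} : gtail R <= 1.
Proof.
rewrite -lee_fin fineK; last exact: integrable_fin_num integrable_gtail.
rewrite -(integral_normal_pdf 0 1); apply: le_integral => //.
- exact: integrable_gtail.
- exact: integrable_normal_pdf.
- by move=> t _; rewrite lee_fin ler_piMl ?normal_pdf_ge0.
Qed.

(** On the unit-length interval [[1, 2]] the density is at least its value at 2. *)
Lemma gtail_gt0 {R : realType} : 0 < gtail R.
Proof.
rewrite -lte_fin fineK; last exact: integrable_fin_num integrable_gtail.
have g2 : 0 < normal_pdf 0 1 (2 : R).
  by rewrite normal_pdfE// mulr_gt0 ?normal_peak_gt0 ?expR_gt0.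
apply: (@lt_le_trans _ _ (gpdf (2 : R))%:E); first by rewrite lte_fin.
rewrite (_ : _%:E = \int[@lebesgue_measure R]_t
    ((gpdf (2 : R))%:E * (\1_(`[(1 : R), 2]) t)%:E)%E)%E; last first.
  rewrite ge0_integralZl//; last 2 first.
  - by apply/measurable_EFinP.
  - by rewrite lee_fin ltW.
  have mu12 : (@lebesgue_measure R) (`[(1 : R), 2]%classic) = 1%:E.
    by rewrite lebesgue_measure_itv/= lte_fin ltr1n -EFinB; congr EFin; lra.
  by rewrite integral_indic// setIT [X in (_ * X)%E]mu12 mule1.
apply: le_integral_ge0 => t.
  by rewrite mule_ge0 ?lee_fin// ltW.
rewrite -EFinM lee_fin indicE.
have [|_] := boolP (t \in _); last first.
  by rewrite mulr0 mulr_ge0// normal_pdf_ge0.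
rewrite inE/= in_itv/= => /andP[t1 t2].
rewrite mulr1 indicE mem_set/=; last by rewrite in_itv/= (ltNge t) t1 andbF.
rewrite mul1r !normal_pdfE// ler_wpM2l ?normal_peak_ge0// ler_expR.
rewrite !subr0 ler_pM2r ?invr_gt0 ?pmulrn_lgt0// ?exprn_gt0//.
by rewrite lerN2 ler_sqr ?nnegrE//; lra.
Qed.

(* The even part h of H satisfies h(t) >= h(0) + 1_{|t| >= 1} (h(1) - h(0)), and
   the expectation of the right-hand side is at least h(P(|gamma| >= 1)). *)
Lemma gauss_jensen {R : realType} (H : R -> R) :
  measurable_fun setT H -> (forall t, 0 <= H t) ->
  (forall a b l : R, 0 <= l -> l <= 1 ->
     H (l * a + (1 - l) * b) <= l * H a + (1 - l) * H b) ->
  (((H (gtail R) + H (- gtail R)) / 2)%:E <=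
   \int[@lebesgue_measure R]_t ((gpdf t)%:E * (H t)%:E))%E.
Proof.
move=> mH H0 cvx; set I := (X in (_ <= X)%E).
have mg : measurable_fun setT (fun t : R => ((gpdf t)%:E * (H t)%:E)%E).
  apply/measurable_EFinP/measurable_funM => //; exact: measurable_normal_pdf.
have g0 (t : R) : (0 <= (gpdf t)%:E * (H t)%:E)%E.
  by rewrite mule_ge0 ?lee_fin ?normal_pdf_ge0.
have symE : I = (\int[@lebesgue_measure R]_t ((gpdf t)%:E * (H (- t))%:E))%E.
  rewrite /I (ge0_integral_oppr _ mg g0).
  by apply: eq_integral => t _; rewrite gpdfN.
have mHN : measurable_fun setT (fun t : R => H (- t)).
  by apply: measurableT_comp => //; exact: oppr_measurable.
(* Twice the even part of [H], at 0 and at 1. *)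
set k0 := 2 * H 0; set k1 := H 1 + H (-1).
have mid (t : R) : k0 <= H t + H (- t).
  have /(_ t (- t) 2^-1) := cvx; rewrite (_ : _ + _ * - t = 0); last by field.
  by rewrite /k0; lra.
(* For [t >= 1], the point 1 is the convex combination of [t] and 0 with weight [t^-1] on [t];
   likewise for -1. The bound [mid] absorbs the contribution of [H 0]. *)
have out (t : R) : 1 <= `|t| -> k1 <= H t + H (- t).
  wlog t0 : t / 0 <= t => [wt|].
    have [/wt//|t0 t1] := leP 0 t.
    by rewrite addrC -{2}(opprK t) wt// ?normrN// oppr_ge0 ltW.
  rewrite ger0_norm// => t1; have tn0 : t != 0 by rewrite gt_eqF//; lra.
  have l0 : 0 <= t^-1 by rewrite invr_ge0.
  have l1 : t^-1 <= 1 by rewrite invf_le1//; lra.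
  have := cvx t 0 t^-1 l0 l1; have := cvx (- t) 0 t^-1 l0 l1.
  rewrite !mulr0 !addr0 mulrN mulVf//.
  have := mid t; rewrite /k0 /k1; nra.
have k10 : k0 <= k1 by exact: mid.
have I2 : ((H (gtail R) + H (- gtail R))%:E <= I + I)%E.
  rewrite {1}symE /I -ge0_integralD//; last 2 first.
  - by move=> t _; rewrite mule_ge0 ?lee_fin ?normal_pdf_ge0.
  - apply/measurable_EFinP/measurable_funM => //; exact: measurable_normal_pdf.
  apply: (@le_trans _ _ (k0 + (k1 - k0) * gtail R)%:E).
    rewrite lee_fin /k0 /k1.
    have t0 : 0 <= gtail R by rewrite ltW// gtail_gt0.
    have := cvx 1 0 (gtail R) t0 gtail_le1.
    have := cvx (-1) 0 (gtail R) t0 gtail_le1.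
    rewrite !mulr0 !addr0 mulrN mulr1; lra.
  rewrite (_ : (_ + _)%:E = \int[@lebesgue_measure R]_t
      (k0%:E * (gpdf t)%:E +
       (k1 - k0)%:E * (\1_(~` `](-1 : R), 1[) t * gpdf t)%:E))%E; last first.
    have ig := @integrable_gtail R; have ip := @integrable_normal_pdf R 0 1.
    rewrite integralD//; [|exact: integrableZl..].
    rewrite !integralZl// integral_normal_pdf mule1 EFinD; congr (_ + _)%E.
    rewrite EFinM /gtail fineK//.
    exact: integrable_fin_num.
  apply: le_integral_ge0 => t.
    rewrite -!EFinM -EFinD lee_fin addr_ge0// mulr_ge0 ?normal_pdf_ge0//.
      by rewrite /k0 mulr_ge0.
      by rewrite subr_ge0.
    by rewrite mulr_ge0 ?normal_pdf_ge0.
  rewrite -!EFinM -!EFinD lee_fin mulrA -mulrDl -mulrDr mulrC.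
  rewrite ler_wpM2l ?normal_pdf_ge0// addrC indicE.
  have [|_] := boolP (t \in _); last by rewrite mulr0 add0r addrC mid.
  rewrite inE/= in_itv/= => tB; rewrite mulr1 subrK addrC out//.
  by rewrite leNgt ltr_norml; apply/negP.
have : (0 <= I)%E by apply: integral_ge0 => t _; exact: g0.
case: I I2 {symE} => [r| |]; last by [].
  by rewrite -EFinD !lee_fin => ? ?; lra.
by move=> _ _; rewrite leey.
Qed.

Lemma sqr_norm_convex {R : realType} {E : normedModType R} (y z : E) (l : R) :
  0 <= l -> l <= 1 ->
  `|l *: y + (1 - l) *: z| ^+ 2 <= l * `|y| ^+ 2 + (1 - l) * `|z| ^+ 2.
Proof.
move=> l0 l1; apply: (@le_trans _ _ ((l * `|y| + (1 - l) * `|z|) ^+ 2)).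
  rewrite ler_sqr ?nnegrE//; last by rewrite addr_ge0// mulr_ge0// subr_ge0.
  rewrite (le_trans (ler_normD _ _))// !normrZ ger0_norm//.
  by rewrite (ger0_norm (x := 1 - l))// subr_ge0.
(* This is exactly the gap in the convexity inequality of the scalar square. *)
have : 0 <= l * (1 - l) * (`|y| - `|z|) ^+ 2.
  by rewrite mulr_ge0 ?sqr_ge0// mulr_ge0// subr_ge0.
by move: `|y| `|z| => a b; lra.
Qed.

(** A version of [rad_sq] made for induction: [u] collects the terms whose random coefficients are
    already fixed. *)
Definition rad_shift {R : realType} {E : normedModType R} (N : nat) (u : E)
    (x : 'I_N -> E) : R :=
  (2 ^+ N)^-1 * \sum_(s : {ffun 'I_N -> bool})
     `| u + \sum_(i < N) (if s i then 1 else -1) *: x i | ^+ 2.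

Definition ffun_cons (N : nat) (bs : bool * {ffun 'I_N -> bool}) :
    {ffun 'I_N.+1 -> bool} :=
  [ffun i => if unlift ord0 i is Some j then bs.2 j else bs.1].

Lemma ffun_cons_bij N : bijective (@ffun_cons N).
Proof.
exists (fun s : {ffun 'I_N.+1 -> bool} =>
  (s ord0, [ffun j => s (lift ord0 j)])) => [[b s]|s].
  congr pair; first by rewrite ffunE unlift_none.
  by apply/ffunP => j; rewrite !ffunE liftK.
by apply/ffunP => i; rewrite ffunE; case: unliftP => [j ->|->] //=; rewrite ffunE.
Qed.

(** Conditioning on the first sign. *)
Lemma rad_shiftS {R : realType} {E : normedModType R} (N : nat) (u : E)
    (x : 'I_N.+1 -> E) :
  rad_shift _ u x =
  (rad_shift _ (u + x ord0) (fun i => x (lift ord0 i)) +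
   rad_shift _ (u - x ord0) (fun i => x (lift ord0 i))) / 2.
Proof.
rewrite /rad_shift (reindex (@ffun_cons N)); last exact/onW_bij/ffun_cons_bij.
rewrite -(pair_bigA _ (fun b s => `|u + \sum_(i < N.+1)
  (if ffun_cons _ (b, s) i then 1 else -1) *: x i| ^+ 2))/= big_bool/=.
have cE b : \sum_(s : {ffun 'I_N -> bool}) `|u + \sum_(i < N.+1)
      (if ffun_cons _ (b, s) i then 1 else -1) *: x i| ^+ 2 =
    \sum_(s : {ffun 'I_N -> bool}) `|u + (if b then 1 else -1) *: x ord0 +
      \sum_(i < N) (if s i then 1 else -1) *: x (lift ord0 i)| ^+ 2.
  apply: eq_bigr => s _; rewrite big_ord_recl addrA ffunE unlift_none.
  congr (`|_ + _| ^+ 2).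
  by apply: eq_bigr => i _; rewrite ffunE liftK.
rewrite !cE scale1r scaleN1r -mulrDr exprS invfM; ring.
Qed.

Lemma rad_shift_ge0 {R : realType} {E : normedModType R} (N : nat) (u : E)
  (x : 'I_N -> E) : 0 <= rad_shift _ u x.
Proof.
by rewrite mulr_ge0 ?invr_ge0 ?exprn_ge0// sumr_ge0// => s _; exact: sqr_ge0.
Qed.

Lemma rad_shift_convex {R : realType} {E : normedModType R} (N : nat) (u v : E)
    (x : 'I_N -> E) (l : R) : 0 <= l -> l <= 1 ->
  rad_shift _ (l *: u + (1 - l) *: v) x <=
  l * rad_shift _ u x + (1 - l) * rad_shift _ v x.
Proof.
move=> l0 l1; rewrite /rad_shift !(mulrCA _ (2 ^+ N)^-1) -mulrDr.
rewrite ler_wpM2l ?invr_ge0 ?exprn_ge0// !mulr_sumr -big_split/=.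
apply: ler_sum => s _; apply: le_trans (sqr_norm_convex _ _ _ l0 l1).
rewrite !scalerDr addrACA -scalerDl (_ : l + (1 - l) = 1) ?scale1r//.
by rewrite addrC subrK.
Qed.

(** Along a line the function is continuous in the real parameter, so measurability in [E] itself
    does not come up. *)
Lemma measurable_rad_shift_line {R : realType} {E : normedModType R} (N : nat)
    (u z : E) (x : 'I_N -> E) :
  measurable_fun setT (fun t : R => rad_shift _ (u + t *: z) x).
Proof.
apply: measurable_funM => //; apply: measurable_sum => s.
apply: measurable_funX; apply: continuous_measurable_fun => t.
apply: cvg_norm; apply: cvgD; last exact: cvg_cst.
by apply: cvgD; [exact: cvg_cst|apply: cvgZl; exact: cvg_id].
Qed.

(** The signs are exchanged for Gaussians one by one: [gauss_jensen] treats the first coordinate,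
    with the remaining ones still Rademacher, and the induction hypothesis is applied under the
    integral with the first term moved into the shift. *)
Lemma rad_shift_le_gexp {R : realType} {E : normedModType R} (N : nat) (u : E)
    (x : 'I_N -> E) :
  ((rad_shift _ u (fun i => gtail R *: x i))%:E <=
   gexp N (fun v => (`|u + \sum_(i < N) v i *: x i| ^+ 2)%:E))%E.
Proof.
elim: N u x => [|N IH] u x /=.
  rewrite lee_fin /rad_shift expr0 invr1 mul1r !big_ord0 addr0.
  under eq_bigr do rewrite big_ord0 addr0.
  by rewrite sumr_const card_ffun card_ord expn0.
rewrite rad_shiftS.
pose H t := rad_shift _ (u + t *: x ord0) (fun i => gtail R *: x (lift ord0 i)).
rewrite -scaleNr -[rad_shift _ (u + _) _]/(H _) -[rad_shift _ (u + _) _]/(H _).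
apply: le_trans (gauss_jensen H _ _ _) _.
- exact: measurable_rad_shift_line.
- by move=> t; exact: rad_shift_ge0.
- move=> a b l l0 l1; rewrite /H; apply: le_trans (rad_shift_convex _ _ _ _ _ l0 l1).
  rewrite !scalerDr addrACA -scalerDl (_ : l + (1 - l) = 1); last by ring.
  by rewrite scale1r !scalerA -scalerDl.
apply: le_integral_ge0 => t.
  by rewrite mule_ge0 ?lee_fin ?normal_pdf_ge0// rad_shift_ge0.
rewrite lee_pmul ?lee_fin ?normal_pdf_ge0 ?rad_shift_ge0//.
apply: le_trans (IH _ _) _; apply: le_gexp => v; first by rewrite lee_fin sqr_ge0.
by rewrite big_ord_recl addrA.
Qed.

Lemma rad_sq_le_gauss_sq {R : realType} {E : normedModType R} (N : nat)
    (x : 'I_N -> E) : ((gtail R ^+ 2 * rad_sq x)%:E <= gauss_sq x)%E.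
Proof.
have := rad_shift_le_gexp _ 0 x; rewrite /gauss_sq.
rewrite (_ : (fun v : nat -> R => _) = (fun v : nat -> R => (`|\sum_(i < N) v i *: x i| ^+ 2)%:E)).
  apply: le_trans; rewrite lee_fin /rad_shift /rad_sq mulrCA.
  rewrite ler_wpM2l ?invr_ge0 ?exprn_ge0// mulr_sumr ler_sum// => s _.
  rewrite add0r [X in _ <= `|X| ^+ 2](_ : _ = gtail R *: \sum_(i < N)
      (if s i then 1 else -1) *: x i); last first.
    by rewrite scaler_sumr; apply: eq_bigr => i _; rewrite !scalerA mulrC.
  by rewrite normrZ exprMn real_normK// num_real.
by apply/funext => v; rewrite add0r.
Qed.

(** * The inner product on L^2(0,1) and Bessel's inequality *)

Lemma L2_integrable_sqr {R : realType} (g : R -> R) : L2 g ->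
  (@lebesgue_measure R).-integrable `](0:R), (1:R)[%classic
    (fun t => (g t ^+ 2)%:E).
Proof.
move=> [mg gfin]; apply/integrableP; split.
  by apply/measurable_EFinP; exact: measurable_funX.
under eq_integral => t _ do rewrite gee0_abs ?lee_fin ?sqr_ge0//.
exact: gfin.
Qed.

Lemma L2_integrableM {R : realType} (g h : R -> R) : L2 g -> L2 h ->
  (@lebesgue_measure R).-integrable `](0:R), (1:R)[%classic
    (fun t => (g t * h t)%:E).
Proof.
move=> Lg Lh; have [mg _] := Lg; have [mh _] := Lh.
apply: (@le_integrable _ _ _ (@lebesgue_measure R) _ _ _
    (fun t => (g t ^+ 2)%:E + (h t ^+ 2)%:E)%E) => //.
- by apply/measurable_EFinP/measurable_funM.
- move=> t _; rewrite -EFinD lee_fin; apply: le_trans (ler_norm _).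
  rewrite normrM -(real_normK (num_real (g t))) -(real_normK (num_real (h t))).
  by move: (normr_ge0 (g t)) (normr_ge0 (h t)); move: `|g t| `|h t| => a b; nra.
- by apply: integrableD => //; exact: L2_integrable_sqr.
Qed.

Lemma L2_0 {R : realType} : @L2 R (fun _ => 0).
Proof.
split; first by [].
by under eq_integral => t _ do rewrite expr0n/=; rewrite integral0.
Qed.

Lemma L2_axpy {R : realType} (a : R) (g h : R -> R) : L2 g -> L2 h ->
  L2 (fun t => a * g t + h t).
Proof.
move=> Lg Lh; have [mg _] := Lg; have [mh _] := Lh; split.
  by apply: measurable_funD => //; exact: measurable_funM.
have ig := L2_integrable_sqr _ Lg; have ih := L2_integrable_sqr _ Lh.
have igh := L2_integrableM _ _ Lg Lh.
under eq_integral => t _.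
  rewrite (_ : (_ ^+ 2)%:E = ((a ^+ 2)%:E * (g t ^+ 2)%:E +
     (2 * a)%:E * (g t * h t)%:E + (h t ^+ 2)%:E)%E); last first.
    by rewrite -!EFinM -!EFinD; congr EFin; ring.
  over.
apply: integrable_lty => //; apply: integrableD => //.
by apply: integrableD => //; exact: integrableZl.
Qed.

Lemma ipC {R : realType} (g h : R -> R) : ip g h = ip h g.
Proof. by apply: eq_Rintegral => t _; rewrite mulrC. Qed.

Lemma ip0l {R : realType} (h : R -> R) : ip (fun _ => 0) h = 0.
Proof.
rewrite /ip /Rintegral; under eq_integral => t _ do rewrite mul0r.
by rewrite integral0.
Qed.

Lemma ip_axpyl {R : realType} (a : R) (g h k : R -> R) : L2 g -> L2 h -> L2 k ->
  ip (fun t => a * g t + h t) k = a * ip g k + ip h k.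
Proof.
move=> Lg Lh Lk; have igk := L2_integrableM _ _ Lg Lk.
have ihk := L2_integrableM _ _ Lh Lk.
rewrite /ip -RintegralZl// -RintegralD//.
  by apply: eq_Rintegral => t _; rewrite mulrDl mulrA.
exact: (integrableZl _ a igk).
Qed.

Lemma L2_sum {R : realType} (M : nat) (c : 'I_M -> R) (e : 'I_M -> R -> R) :
  (forall i, L2 (e i)) -> L2 (fun t => \sum_(i < M) c i * e i t).
Proof.
elim: M c e => [|M IH] c e Le.
  by under eq_fun do rewrite big_ord0; exact: L2_0.
under eq_fun do rewrite big_ord_recl.
by apply: L2_axpy => //; apply: (IH (fun i => c (lift ord0 i))).
Qed.

Lemma ip_suml {R : realType} (M : nat) (c : 'I_M -> R) (e : 'I_M -> R -> R)
    (k : R -> R) : (forall i, L2 (e i)) -> L2 k ->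
  ip (fun t => \sum_(i < M) c i * e i t) k = \sum_(i < M) c i * ip (e i) k.
Proof.
move=> Le Lk; elim: M c e Le => [|M IH] c e Le.
  by under eq_fun do rewrite big_ord0; rewrite ip0l big_ord0.
under eq_fun do rewrite big_ord_recl.
rewrite big_ord_recl ip_axpyl//; last first.
  exact: (L2_sum _ (fun i => c (lift ord0 i))).
by rewrite (IH (fun i => c (lift ord0 i)) (fun i => e (lift ord0 i))).
Qed.

Lemma ip_ge0 {R : realType} (g : R -> R) : 0 <= ip g g.
Proof. by apply: Rintegral_ge0 => t _; rewrite -expr2 sqr_ge0. Qed.

(** With [q] the projection of [h] onto the span of the [e i], expanding the square norm of [h - q]
    gives [ip h h - S], which is nonnegative. *)
Lemma bessel {R : realType} (M : nat) (e : 'I_M -> R -> R) (h : R -> R) :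
  Defs.orthonormal e -> L2 h -> \sum_(i < M) ip (e i) h ^+ 2 <= ip h h.
Proof.
move=> [Le oe] Lh; set S := \sum_(i < M) _.
pose q t := \sum_(i < M) ip (e i) h * e i t.
have Lq : L2 q by exact: L2_sum.
have qh : ip q h = S.
  by rewrite /q ip_suml//; apply: eq_bigr => i _; rewrite expr2.
have qq : ip q q = S.
  rewrite {1}/q ip_suml//; apply: eq_bigr => i _.
  rewrite (ipC _ q) /q ip_suml// expr2; congr (_ * _).
  rewrite (bigD1 i)//= oe eqxx mulr1 big1 ?addr0// => j ji.
  by rewrite oe (negbTE ji) mulr0.
have := ip_ge0 (fun t => -1 * q t + h t).
have Lqh : L2 (fun t => -1 * q t + h t) by exact: L2_axpy.
rewrite ip_axpyl// (ipC q) (ipC h) !ip_axpyl// qh qq (ipC h) qh; lra.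
Qed.

(** * Gamma-norms of finite rank operators *)

(** A crude Cauchy-Schwarz inequality, serving a finiteness claim: the constant doubles at each step
    because (a + s)^2 <= 2 a^2 + 2 s^2. *)
Lemma sqr_sum_le {R : realType} (N : nat) (a : 'I_N -> R) :
  (\sum_(n < N) a n) ^+ 2 <= 2 ^+ N * \sum_(n < N) a n ^+ 2.
Proof.
elim: N a => [|N IH] a; first by rewrite !big_ord0 mulr0 expr0n.
rewrite !big_ord_recl (exprS 2); have := IH (fun i => a (lift ord0 i)).
set s := \sum_(i < N) _; set q := \sum_(i < N) _ => sq.
have k1 : 1 <= 2 ^+ N :> R by rewrite exprn_ege1// ler1n.
have : 0 <= (2 ^+ N - 1) * a ord0 ^+ 2 by rewrite mulr_ge0 ?sqr_ge0// subr_ge0.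
by have := sqr_ge0 (a ord0 - s); move: sq; move: (2 ^+ N) => k; lra.
Qed.

(* [gamma_sq] is a supremum over all representations of the operator; Bessel's
   inequality bounds it uniformly in the orthonormal system. *)
Lemma gamma_sq_frank_lty {R : realType} {E : normedModType R} (r : frank E) :
  fr_ok r -> (gamma_sq (fr_app r) < +oo)%E.
Proof.
move=> rok; pose N := frN r.
pose B := \sum_(n < N) (2 ^+ N * `|frx r n| ^+ 2) *
  (0 ^+ 2 + gvar R * ip (frh r n) (frh r n)).
apply: (@le_lt_trans _ _ B%:E); last exact: ltry.
apply: ge_ereal_sup => _ [M [e [oe _ ->]]].
rewrite /gauss_sq.
(* The squared norm is dominated pointwise by a weighted sum of squares of linear forms in [v],
   whose expectation [gexp_sum_sqr] computes; the 0 is the shift in that lemma. *)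
apply: (@le_trans _ _ (gexp M (fun v => (\sum_(n < N) (2 ^+ N * `|frx r n| ^+ 2) *
   (0 + \sum_(i < M) ip (e i) (frh r n) * v i) ^+ 2)%:E))).
  apply: le_gexp => v; first by rewrite lee_fin sqr_ge0.
  rewrite lee_fin.
  rewrite (_ : \sum_(i < M) v i *: fr_app r (e i) =
     \sum_(n < N) (\sum_(i < M) ip (e i) (frh r n) * v i) *: frx r n); last first.
    rewrite /fr_app; under eq_bigr do rewrite scaler_sumr.
    rewrite exchange_big/=; apply: eq_bigr => n _.
    by rewrite scaler_suml; apply: eq_bigr => i _; rewrite scalerA mulrC.
  apply: le_trans (_ : (\sum_(n < N) `|(\sum_(i < M) ip (e i) (frh r n) * v i)
     *: frx r n|) ^+ 2 <= _).
    by rewrite ler_sqr ?nnegrE ?sumr_ge0// ler_norm_sum.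
  apply: le_trans (sqr_sum_le _ _) _; rewrite mulr_sumr ler_sum// => n _.
  by rewrite normrZ exprMn real_normK ?num_real// add0r mulrA mulrAC.
rewrite gexp_sum_sqr lee_fin /B ler_sum// => n _.
rewrite ler_wpM2l ?mulr_ge0 ?sqr_ge0// lerD2l ler_wpM2l ?bessel//.
rewrite /gvar fine_ge0// integral_ge0// => t _.
by rewrite lee_fin mulr_ge0 ?sqr_ge0 ?normal_pdf_ge0.
Qed.

Lemma linfun_sum {R : realType} {E : normedModType R} (phi : E -> R) (N : nat)
    (a : 'I_N -> R) (x : 'I_N -> E) : Defs.linfun phi ->
  phi (\sum_(n < N) a n *: x n) = \sum_(n < N) phi (x n) * a n.
Proof.
move=> lphi; elim: N a x => [|N IH] a x.
  rewrite !big_ord0; have := lphi 1 0 0.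
  by rewrite scale1r addr0 mul1r; lra.
by rewrite !big_ord_recl lphi IH mulrC.
Qed.

Lemma gauss_sq0 {R : realType} {E : normedModType R} (M : nat) :
  gauss_sq (fun _ : 'I_M => (0 : E)) = 0%E.
Proof.
(* Zero is written as an empty sum of squares so that [gexp_sum_sqr] applies. *)
rewrite /gauss_sq (_ : (fun v : nat -> R => _) = (fun v : nat -> R =>
  (\sum_(n < 0) (0 : R) * (0 + \sum_(i < M) (0 : R) * v i) ^+ 2)%:E)).
  by rewrite gexp_sum_sqr big_ord0.
apply/funext => v; rewrite big_ord0 big1 ?normr0 ?expr0n// => i _.
by rewrite scaler0.
Qed.

Lemma gauss_sq_ge0 {R : realType} {E : normedModType R} (M : nat)
  (y : 'I_M -> E) : (0 <= gauss_sq y)%E.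
Proof. by apply: gexp_ge0 => v; rewrite lee_fin sqr_ge0. Qed.

(** The integral operator of this function has finite rank and is represented by the constant
    sequence [r], so [c ^+ 2] can be taken to be [gamma_sq (fr_app r)], which is finite. The system
    [e] itself competes in that supremum and contributes [gauss_sq x], since the operator sends
    [e i] to [x i]. *)
Lemma gamma_norm_orthonormal {R : realType} {E : normedModType R} (N : nat)
    (e : 'I_N -> R -> R) (x : 'I_N -> E) : Defs.orthonormal e ->
  exists c, gamma_norm_is (fun t => \sum_(n < N) e n t *: x n) c /\
    (gauss_sq x <= (c ^+ 2)%:E)%E.
Proof.
move=> oe; have [Le ee] := oe.
pose r := FRank e x; have rok : fr_ok r by [].
have rE i : fr_app r (e i) = x i.
  rewrite /fr_app /= (bigD1 i)//= ee eqxx scale1r big1 ?addr0// => j ji.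
  by rewrite ee eq_sym (negbTE ji) scale0r.
have gx : (gauss_sq x <= gamma_sq (fr_app r))%E.
  apply: ereal_sup_ubound; exists N, e; split => //.
    by move=> g Lg; rewrite /fr_app; apply: eq_bigr => i _; rewrite -/(fr_app _ _) rE.
  by congr gauss_sq; apply/funext => i; rewrite rE.
have g0 : (0 <= gamma_sq (fr_app r))%E := le_trans (gauss_sq_ge0 _ x) gx.
have gfin : gamma_sq (fr_app r) \is a fin_num.
  by rewrite ge0_fin_numE// gamma_sq_frank_lty.
have cE : ((Num.sqrt (fine (gamma_sq (fr_app r))) ^+ 2)%:E = gamma_sq (fr_app r))%E.
  by rewrite sqr_sqrtr ?fineK// fine_ge0.
exists (Num.sqrt (fine (gamma_sq (fr_app r)))); split; last by rewrite cE.
split; first exact: sqrtr_ge0.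
exists (fun=> r); split.
- by [].
- have -> : opdist (fun t => \sum_(n < N) e n t *: x n) (fr_app r) = 0%E.
    apply/eqP; rewrite eq_le; apply/andP; split.
      apply: ge_ereal_sup => _ [phi [g [lphi _ Lg _ ->]]].
      rewrite lee_fin [X in X - _](_ : _ = phi (fr_app r g)) ?subrr ?normr0//.
      rewrite /fr_app linfun_sum//=.
      under eq_bigr do rewrite ipC.
      rewrite -ip_suml// /ip; apply: eq_Rintegral => t _.
      by rewrite linfun_sum.
    (* The zero functional and the zero function show that 0 belongs to the set, so the supremum is
       not below 0. *)
    apply: ereal_sup_ubound; exists (fun=> 0), (fun=> 0); split.
    + by move=> a y z; rewrite mulr0 addr0.
    + by move=> y; rewrite normr0.
    + exact: L2_0.
    + by under eq_integral => t _ do rewrite expr0n/=; rewrite integral0.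
    + rewrite subr0 /Rintegral; under eq_integral => t _ do rewrite mulr0.
      by rewrite integral0 normr0.
  exact: cvg_cst.
- move=> d d0; exists 0%N => k l _ _.
  apply: ge_ereal_sup => _ [M [b [_ _ ->]]].
  rewrite (_ : (fun i => _) = (fun=> 0)); last first.
    by apply/funext => i; rewrite subrr.
  by rewrite gauss_sq0 lee_fin ltW.
- by rewrite cE; exact: cvg_cst.
Qed.

(** * Normalized tent functions *)

(** The slopes are 1 and -1 whatever the length [l], so all tents share the Lipschitz constant 1;
    the peak is [l / 2]. *)
Definition tent {R : realType} (a l t : R) : R :=
  Num.max 0 (l / 2 - `|t - (a + l / 2)|).

Lemma tent_ge0 {R : realType} (a l t : R) : 0 <= tent a l t.
Proof. by rewrite le_max lexx. Qed.

Lemma tent_le {R : realType} (a l t : R) : 0 <= l -> tent a l t <= l / 2.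
Proof. by move=> l0; rewrite ge_max divr_ge0//= gerBl. Qed.

Lemma tent_out {R : realType} (a l t : R) : ~~ (a < t < a + l) -> tent a l t = 0.
Proof.
move=> out; apply/max_idPl; rewrite subr_le0; move: out.
rewrite negb_and -!leNgt => /orP[ta|ta]; rewrite ler_normr.
  by apply/orP; right; lra.
by apply/orP; left; lra.
Qed.

Lemma tent_lip {R : realType} (a l s t : R) :
  `|tent a l t - tent a l s| <= `|t - s|.
Proof.
rewrite /tent; move: (a + l / 2) => m.
rewrite (_ : `|t - s| = `|(t - m) - (s - m)|); last by congr `|_|; ring.
move: (t - m) (s - m) => u v.
have := lerB_dist u v; have := lerB_dist v u; rewrite (distrC v u).
rewrite !maxElt ler_norml; move: `|u - v| `|u| `|v| (l / 2) => d x y k.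
by do 2 case: ifP => ?; move=> ? ?; apply/andP; split; lra.
Qed.

Lemma tent_mid {R : realType} (a l t : R) : a + l / 4 <= t <= a + l * 3 / 4 ->
  l / 4 <= tent a l t.
Proof.
move=> /andP[t1 t2]; rewrite le_max; apply/orP; right.
by rewrite lerBrDr -lerBrDl ler_norml; apply/andP; split; lra.
Qed.

Lemma measurable_tent {R : realType} (a l : R) : measurable_fun setT (tent a l).
Proof.
apply: measurable_maxr => //; apply: measurable_funB => //.
by apply: measurableT_comp => //; exact: measurable_funB.
Qed.

Lemma L2_tent {R : realType} (a l : R) : 0 <= l -> L2 (tent a l).
Proof.
move=> l0; split; first by apply: measurable_funTS; exact: measurable_tent.
apply: (@le_lt_trans _ _ (\int[@lebesgue_measure R]_(t in `](0:R)%R, (1:R)%R[%classic)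
    ((l / 2) ^+ 2)%:E)%E).
  apply: ge0_le_integral => //.
  - by move=> t _; rewrite lee_fin sqr_ge0.
  - apply/measurable_EFinP/measurable_funX; apply: measurable_funTS.
    exact: measurable_tent.
  - by move=> t _; rewrite lee_fin ler_sqr ?nnegrE ?tent_ge0 ?tent_le// divr_ge0.
have mu01 : (@lebesgue_measure R) (`](0 : R), 1[%classic) = 1%:E.
  by rewrite lebesgue_measure_itv/= lte_fin ltr01 -EFinB subr0.
by rewrite integral_cst// [X in (_ * X)%E]mu01 mule1 ltry.
Qed.

(** The tent is at least [l / 4] on the middle half of its support, which has length [l / 2]. *)
Lemma ip_tent_ge {R : realType} (a l : R) : 0 < l -> 0 <= a -> a + l <= 1 ->
  l ^+ 3 / 32 <= ip (tent a l) (tent a l).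
Proof.
move=> l0 a0 al; have Lt := L2_tent a _ (ltW l0).
have it := L2_integrableM _ _ Lt Lt.
rewrite -lee_fin /ip /Rintegral fineK; last exact: integrable_fin_num.
pose B : set R := `[a + l / 4, a + l * 3 / 4]%classic.
have muB : (@lebesgue_measure R) B = (l / 2)%:E.
  have lt : a + l / 4 < a + l * 3 / 4 by lra.
  by rewrite lebesgue_measure_itv/= lte_fin lt -EFinB; congr EFin; field.
have mB : measurable B by exact: measurable_itv.
have BS : B `<=` `](0:R), (1:R)[%classic.
  by move=> t; rewrite /B/= !in_itv/= => /andP[? ?]; apply/andP; split; lra.
apply: (@le_trans _ _ (\int[@lebesgue_measure R]_(t in B) ((l / 4) ^+ 2)%:E)%E).
  by rewrite integral_cst// [X in (_ * X)%E]muB -EFinM lee_fin; lra.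
apply: (@le_trans _ _ (\int[@lebesgue_measure R]_(t in B)
    (tent a l t * tent a l t)%:E)%E).
  apply: ge0_le_integral => //.
  - by move=> t _; rewrite lee_fin sqr_ge0.
  - by apply: measurable_funS (measurable_int _ it).
  - move=> t; rewrite /B/= in_itv/= => tB; rewrite lee_fin -expr2.
    by rewrite ler_sqr ?nnegrE ?tent_ge0 ?divr_ge0 ?(ltW l0)// tent_mid.
apply: ge0_subset_integral => //; first exact: measurable_int it.
by move=> t _; rewrite lee_fin mulr_ge0 ?tent_ge0.
Qed.

Definition ntent {R : realType} (a l t : R) : R :=
  (Num.sqrt (ip (tent a l) (tent a l)))^-1 * tent a l t.

Lemma ntent_out {R : realType} (a l t : R) :
  ~~ (a < t < a + l) -> ntent a l t = 0.
Proof. by move=> out; rewrite /ntent tent_out ?mulr0. Qed.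

Lemma ip_ntent {R : realType} (a l b k : R) : 0 <= l -> 0 <= k ->
  ip (ntent a l) (ntent b k) =
  (Num.sqrt (ip (tent a l) (tent a l)))^-1 *
  (Num.sqrt (ip (tent b k) (tent b k)))^-1 * ip (tent a l) (tent b k).
Proof.
move=> l0 k0; rewrite /ip -RintegralZl//; last first.
  by apply: L2_integrableM; exact: L2_tent.
by apply: eq_Rintegral => t _; rewrite /ntent mulrACA.
Qed.

Lemma L2_ntent {R : realType} (a l : R) : 0 <= l -> L2 (ntent a l).
Proof.
move=> l0; rewrite /ntent.
have := L2_axpy (Num.sqrt (ip (tent a l) (tent a l)))^-1 (tent a l) (fun=> 0)
  (L2_tent _ _ l0) L2_0.
by under eq_fun do rewrite addr0.
Qed.

Lemma ntent_orthonormal {R : realType} (N : nat) (a l : 'I_N -> R) :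
  (forall n, 0 < l n) -> (forall n, 0 <= a n) -> (forall n, a n + l n <= 1) ->
  (forall n m, n != m -> a n + l n <= a m \/ a m + l m <= a n) ->
  Defs.orthonormal (fun n => ntent (a n) (l n)).
Proof.
move=> l0 a0 al dis; have l0' n := ltW (l0 n); split => [n|n m].
  exact: L2_ntent.
rewrite ip_ntent//; have [->|nm] := eqVneq n m.
  set q := ip _ _; have q0 : 0 < q.
    by apply: lt_le_trans (ip_tent_ge _ _ _ _ _) => //; rewrite divr_gt0 ?exprn_gt0.
  by rewrite -invfM -expr2 sqr_sqrtr ?(ltW q0)// mulVf// gt_eqF.
rewrite (_ : ip (tent (a n) (l n)) (tent (a m) (l m)) = 0) ?mulr0//.
rewrite -[RHS](ip0l (fun=> 0)) /ip; apply: eq_Rintegral => t _; rewrite mul0r.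
have [tn|tn] := boolP (a n < t < a n + l n); last by rewrite tent_out ?mul0r.
rewrite [X in _ * X]tent_out ?mulr0//; apply/negP => tm.
by move/andP: tn => [? ?]; move/andP: tm => [? ?]; case: (dis _ _ nm) => ?; lra.
Qed.

(** * Hölder estimates for disjoint bumps *)

(** An increment of the tent is at most both [|t - s|] and [l], hence at most |t - s|^alpha l^(1 -
    alpha) by interpolation. Normalization costs a factor 6 l^(-3/2), and the bound on [y] supplies
    l^(1/2 + alpha), so all powers of [l] cancel. *)
Lemma ntent_holder {R : realType} (a l alpha A y s t : R) :
  0 < l -> 0 <= a -> a + l <= 1 -> 0 < alpha -> alpha < 1 -> 0 <= A -> 0 <= y ->
  y <= A * l `^ (2^-1 + alpha) ->
  `|ntent a l t - ntent a l s| * y <= 6 * A * `|t - s| `^ alpha.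
Proof.
move=> l0 a0 al alpha0 alpha1 A0 y0 yA; have l0' := ltW l0.
rewrite /ntent -mulrBr normrM; set q := ip _ _; set D := `|tent _ _ _ - _|.
set d := `|t - s|.
pose L := l `^ (3 / 2).
have L0 : 0 < L by rewrite powR_gt0.
have LL : L ^+ 2 = l ^+ 3.
  by rewrite -!powR_mulrn ?powR_ge0// -powRrM; congr (_ `^ _); field.
have LE : l `^ (1 - alpha) * l `^ (2^-1 + alpha) = L.
  rewrite -powRD; last by rewrite (lt0r_neq0 l0) implybT.
  by congr (_ `^ _); field.
(* The constant 6 is an integer above the square root of the 32 in [ip_tent_ge]. *)
have qL : (Num.sqrt q)^-1 <= 6 / L.
  rewrite -(invf_div L) lef_pV2 ?posrE ?divr_gt0//; last first.
    by rewrite sqrtr_gt0 (lt_le_trans _ (ip_tent_ge _ _ l0 a0 al))// divr_gt0 ?exprn_gt0.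
  rewrite -[leLHS]ger0_norm ?divr_ge0 ?(ltW L0)// -sqrtr_sqr ler_wsqrtr//.
  apply: le_trans (ip_tent_ge _ _ l0 a0 al); rewrite exprMn LL.
  by have := exprn_ge0 3 l0'; lra.
have D0 : 0 <= D by exact: normr_ge0.
have Dd : D <= d by exact: tent_lip.
have Dl : D <= l.
  have := tent_le a l t l0'; have := tent_le a l s l0'.
  have := tent_ge0 a l t; have := tent_ge0 a l s.
  by rewrite /D ler_norml => ? ? ? ?; apply/andP; split; lra.
have DE : D <= d `^ alpha * l `^ (1 - alpha).
  have [->|Dn0] := eqVneq D 0; first by rewrite mulr_ge0 ?powR_ge0.
  have -> : D = D `^ alpha * D `^ (1 - alpha).
    by rewrite -powRD ?Dn0 ?implybT// addrC subrK powRr1.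
  by apply: ler_pM; rewrite ?powR_ge0//; apply: ge0_ler_powR; rewrite ?nnegrE//; lra.
rewrite ger0_norm ?invr_ge0 ?sqrtr_ge0//.
apply: (@le_trans _ _ ((6 / L) * (d `^ alpha * l `^ (1 - alpha)) *
   (A * l `^ (2^-1 + alpha)))).
  by rewrite ler_pM// ?mulr_ge0 ?invr_ge0 ?sqrtr_ge0// ler_pM// invr_ge0 sqrtr_ge0.
rewrite le_eqVlt; apply/orP; left; apply/eqP.
transitivity (6 * A * d `^ alpha / L * (l `^ (1 - alpha) * l `^ (2^-1 + alpha))).
  by ring.
by rewrite LE divfK// gt_eqF.
Qed.

(** Applied to disjoint intervals, it counts those containing a given point. *)
Lemma sum_unique_le1 {R : realType} (N : nat) (P : pred 'I_N) :
  (forall n m, P n -> P m -> n = m) -> \sum_(n < N) (P n)%:R <= 1 :> R.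
Proof.
move=> uniqP; have [[n Pn]|noP] := pselect (exists n, P n).
  rewrite (bigD1 n)//= Pn big1 ?addr0// => m mn.
  by case: (boolP (P m)) => // Pm; rewrite (uniqP _ _ Pm Pn) eqxx in mn.
rewrite big1// => n _; case: (boolP (P n)) => // Pn.
by exfalso; apply: noP; exists n.
Qed.

(** The constant is 6 for the supremum norm plus 12 for the seminorm. Nonnegativity is included
    because the norm is a sum of extended suprema, and it is needed when multiplying by
    constants. *)
Lemma holder_norm_sum_ntent {R : realType} {E : normedModType R} (N : nat)
    (a l : 'I_N -> R) (x : 'I_N -> E) (alpha A : R) :
  (forall n, 0 < l n) -> (forall n, 0 <= a n) -> (forall n, a n + l n <= 1) ->
  (forall n m, n != m -> a n + l n <= a m \/ a m + l m <= a n) ->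
  0 < alpha -> alpha < 1 -> 0 <= A ->
  (forall n, `|x n| <= A * l n `^ (2^-1 + alpha)) ->
  (0 <= holder_norm alpha (fun t => (\sum_(n < N) ntent (a n) (l n) t *: x n)%R)
   <= (18 * A)%:E)%E.
Proof.
move=> l0 a0 al dis alpha0 alpha1 A0 xA; set f := fun t : R => _.
pose P t n := a n < t < a n + l n.
have Puniq t n m : P t n -> P t m -> n = m.
  move=> /andP[? ?] /andP[? ?]; apply/eqP/negPn/negP => nm.
  by case: (dis _ _ nm) => ?; lra.
have f_le (t : R) : 0 <= t <= 1 -> `|f t| <= 6 * A.
  move=> /andP[t0 t1].
  apply: (@le_trans _ _ (\sum_(n < N) (P t n)%:R * (6 * A))); last first.
    rewrite -mulr_suml ler_piMl ?mulr_ge0//.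
    by apply: sum_unique_le1 => n m; exact: Puniq.
  apply: le_trans (ler_norm_sum _ _ _) _; apply: ler_sum => n _.
  rewrite normrZ; have [tn|tn] := boolP (P t n); last by rewrite ntent_out ?normr0 ?mul0r.
  have /(_ (a n) t) := fun s u => ntent_holder (a n) (l n) alpha A `|x n| s u
    (l0 n) (a0 n) (al n) alpha0 alpha1 A0 (normr_ge0 _) (xA n).
  (* The value at [t] is the increment from the left endpoint [a n], where the bump vanishes; the
     distance is at most 1. *)
  rewrite (ntent_out (a n) (l n) (a n)) ?ltxx// subr0 mul1r => /le_trans; apply.
  rewrite ler_piMr ?mulr_ge0//.
  rewrite [leRHS](_ : 1 = 1 `^ alpha); last by rewrite powR1.
  apply: ge0_ler_powR; rewrite ?nnegrE ?ler01 ?(ltW alpha0)//.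
  move/andP: tn => [? ?]; have := al n; have := a0 n.
  by rewrite ler_norml => ? ?; apply/andP; split; lra.
have f_holder (s t : R) : `|f t - f s| <= 12 * A * `|t - s| `^ alpha.
  (* Only the terms whose interval contains [t] or [s] contribute, and there are at most two of
     them. *)
  apply: (@le_trans _ _ (\sum_(n < N) ((P t n)%:R + (P s n)%:R) *
     (6 * A * `|t - s| `^ alpha))); last first.
    have K0 : 0 <= 6 * A * `|t - s| `^ alpha by rewrite !mulr_ge0 ?powR_ge0.
    rewrite -mulr_suml big_split/=.
    rewrite (_ : 12 * A * _ = 2 * (6 * A * `|t - s| `^ alpha)); last by ring.
    rewrite ler_wpM2r// (_ : 2 = 1 + 1); last by ring.
    by apply: lerD; apply: sum_unique_le1; exact: Puniq.
  rewrite /f -sumrB; apply: le_trans (ler_norm_sum _ _ _) _; apply: ler_sum => n _.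
  rewrite -scalerBl normrZ.
  have H := ntent_holder (a n) (l n) alpha A `|x n| s t
    (l0 n) (a0 n) (al n) alpha0 alpha1 A0 (normr_ge0 _) (xA n).
  have K0 : 0 <= 6 * A * `|t - s| `^ alpha by rewrite !mulr_ge0 ?powR_ge0.
  have [tn|tn] := boolP (P t n).
    by apply: le_trans H _; rewrite ler_peMl// lerDl.
  have [sn|sn] := boolP (P s n); first by rewrite add0r mul1r.
  by rewrite !ntent_out// subrr normr0 !mul0r addr0 mul0r.
rewrite /holder_norm; apply/andP; split.
  apply: adde_ge0.
    apply: (@le_trans _ _ (`|f 0|)%:E); first by rewrite lee_fin.
    by apply: ereal_sup_ubound; exists 0 => //; rewrite /= in_itv/= lexx ler01.
  apply: (@le_trans _ _ (`|f 1 - f 0| / (1 - 0) `^ alpha)%:E).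
    by rewrite lee_fin divr_ge0// powR_ge0.
  apply: ereal_sup_ubound; exists 0, 1; split => //=.
    by rewrite in_itv/= lexx ler01.
  by rewrite in_itv/= lexx ler01.
rewrite (_ : 18 * A = 6 * A + 12 * A); last by ring.
rewrite EFinD; apply: leeD; apply: ge_ereal_sup.
  by move=> _ [t tI <-]; rewrite lee_fin f_le.
move=> _ [s [t [_ _ st ->]]]; rewrite lee_fin ler_pdivrMr ?powR_gt0 ?subr_gt0//.
by have := f_holder s t; rewrite (ger0_norm (x := t - s))// subr_ge0 ltW.
Qed.

(** * Splitting the unit interval *)

Lemma partial_sum_le {R : realType} (N : nat) (l : 'I_N -> R) (n : 'I_N) (m : nat) :
  (forall i, 0 <= l i) -> (n < m)%N ->
  (\sum_(i < N | (i < n)%N) l i) + l n <= \sum_(i < N | (i < m)%N) l i.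
Proof.
move=> l0 nm; rewrite [leRHS](bigID (fun i : 'I_N => (i < n)%N))/=.
rewrite [X in _ <= X + _](eq_bigl (fun i : 'I_N => (i < n)%N)); last first.
  move=> i; have [ni|_] := ltnP i n; last by rewrite andbF.
  by rewrite (ltn_trans ni nm).
rewrite lerD2l (bigD1 n)/=; last by rewrite nm ltnn.
by rewrite lerDl sumr_ge0.
Qed.

(* The weight [/ N] in the lengths keeps the intervals of zero vectors nondegenerate. *)
Lemma disjoint_intervals {R : realType} (N : nat) (w : 'I_N -> R) :
  (forall n, 0 <= w n) -> 0 < \sum_(n < N) w n ->
  exists a l : 'I_N -> R,
    [/\ forall n, 0 < l n, forall n, 0 <= a n, forall n, a n + l n <= 1,
        forall n m, n != m -> a n + l n <= a m \/ a m + l m <= a n &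
        forall n, w n <= 2 * (\sum_(n < N) w n) * l n].
Proof.
move=> w0; set S := \sum_(n < N) w n => S0.
case: N => [|N] in w w0 @S S0 *; first by move: S0; rewrite /S big_ord0 ltxx.
have N0 : 0 < N.+1%:R :> R by rewrite ltr0n.
(* Half of the unit length is shared in proportion to [w], the other half equally. *)
pose l n := w n / (2 * S) + (2 * N.+1%:R)^-1.
pose a (n : 'I_N.+1) := \sum_(i < N.+1 | (i < n)%N) l i.
have l0 n : 0 < l n.
  by rewrite ltr_wpDl ?invr_gt0 ?mulr_gt0// mulr_ge0 ?w0// invr_ge0 mulr_ge0// ltW.
have l0' n := ltW (l0 n).
have suml : \sum_(n < N.+1) l n = 1.
  rewrite big_split/= -mulr_suml sumr_const card_ord -/S -[X in _ + X]mulr_natl !invfM.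
  rewrite (mulrCA S) divff ?(lt0r_neq0 S0)// mulrCA divff ?(lt0r_neq0 N0)//.
  by field.
exists a, l; split=> //.
- by move=> n; apply: sumr_ge0.
- move=> n; apply: le_trans (partial_sum_le _ _ _ N.+1 l0' (ltn_ord n)) _.
  by rewrite -[leRHS]suml (eq_bigl predT)// => i; exact: ltn_ord.
- move=> n m; rewrite -val_eqE neq_ltn => /orP[nm|mn]; [left|right];
    exact: partial_sum_le.
- move=> n; rewrite /l mulrDr mulrCA divff ?mulr1; last by rewrite gt_eqF ?mulr_gt0.
  by rewrite lerDl mulr_ge0 ?invr_ge0 ?mulr_ge0 ?ltW.
Qed.

(** * From the embedding to type p *)

Theorem theorem3p5 (R : realType) (E : completeNormedModType R) (p alpha : R) :
  1 < p -> p < 2 -> 0 < alpha -> alpha < p^-1 - 2^-1 ->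
  (exists C : R, forall f : R -> E, (holder_norm alpha f < +oo)%E ->
      in_gamma f /\ forall c, gamma_norm_is f c -> (c%:E <= C%:E * holder_norm alpha f)%E) ->
  has_type E p.
Proof.
move=> p1 p2 alpha0 alpha_lt [C embed].
have p0 : 0 < p by lra.
have pV1 : p^-1 < 1 by rewrite invf_lt1.
have pV0 : 0 < p^-1 by rewrite invr_gt0.
have alpha1 : alpha < 1 by lra.
have g0 := @gtail_gt0 R.
(* Here 36 is 18 from the Hölder bound times 2 from [A] below; the absolute value covers a negative
   [C]. *)
exists ((gtail R)^-1 * (`|C| * 36)) => N x.
pose w n := `|x n| `^ p; rewrite -/(\sum_(n < N) w n); set S := \sum_(n < N) w n.
have w0 n : 0 <= w n by exact: powR_ge0.
have K0 : 0 <= (gtail R)^-1 * (`|C| * 36) by rewrite mulr_ge0 ?invr_ge0 ?(ltW g0)// mulr_ge0.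
have : 0 <= S by rewrite sumr_ge0.
rewrite le_eqVlt => /predU1P[S0|S0].
  (* When [S = 0] the intervals cannot be built, but all vectors vanish. *)
  have x0 n : x n = 0.
    apply/eqP; rewrite -normr_eq0.
    have : w n == 0.
      by move: S0 => /esym/eqP; rewrite psumr_eq0// => /allP/(_ n (mem_index_enum _)).
    by rewrite /w powR_eq0 => /andP[].
  rewrite /rad_sq big1 => [|s _].
    by rewrite mulr0 sqrtr0; exact: mulr_ge0 K0 (powR_ge0 _ _).
  by rewrite big1 ?normr0 ?expr0n// => i _; rewrite x0 scaler0.
have [a [l [l0 a0 al dis wl]]] := disjoint_intervals N w w0 S0.
(* The factor 2 bounds 2^(1/p), which comes from [w n <= 2 * S * l n]. *)
pose A := 2 * S `^ p^-1.
have A0 : 0 <= A by rewrite mulr_ge0 ?powR_ge0.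
have xA n : `|x n| <= A * l n `^ (2^-1 + alpha).
  have l1 : l n <= 1 by have := al n; have := a0 n; lra.
  have -> : `|x n| = w n `^ p^-1.
    by rewrite /w -powRrM divff ?powRr1// gt_eqF.
  apply: (@le_trans _ _ ((2 * S * l n) `^ p^-1)).
    apply: ge0_ler_powR; rewrite ?nnegrE ?(ltW pV0) ?wl//.
    by rewrite !mulr_ge0 ?(ltW S0) ?(ltW (l0 n)).
  rewrite !powRM ?mulr_ge0 ?(ltW S0) ?(ltW (l0 n))// /A.
  apply: ler_pM; rewrite ?mulr_ge0 ?powR_ge0//.
    rewrite ler_wpM2r ?powR_ge0// -[leRHS](@powRr1 _ 2)//.
    by rewrite ler_powR ?ler1n// ltW.
  (* The condition on [alpha] enters here: since [l n <= 1] and 1/2 + alpha < 1/p, the smaller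
     exponent gives the larger power. *)
  apply: ger_powR; first by rewrite l0 l1.
  by lra.
have /andP[h0 hA] := holder_norm_sum_ntent N a l x alpha A l0 a0 al dis alpha0 alpha1 A0 xA.
set f := fun t : R => _ in h0 hA.
have orth := ntent_orthonormal N a l l0 a0 al dis.
have [c [fc gc]] := gamma_norm_orthonormal N _ x orth.
have [_ /(_ c fc) cC] := embed f (le_lt_trans hA (ltry _)).
have cA : c <= `|C| * (18 * A).
  rewrite -lee_fin; apply: (le_trans cC); rewrite EFinM.
  apply: le_trans (_ : `|C|%:E * holder_norm alpha f <= _)%E.
    by rewrite lee_wpmul2r// lee_fin ler_norm.
  by rewrite lee_wpmul2l.
have c0 : 0 <= c by case: fc.
have := le_trans (rad_sq_le_gauss_sq _ x) gc; rewrite lee_fin => rc.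
have {}rc : gtail R * Num.sqrt (rad_sq x) <= c.
  rewrite -(ger0_norm c0) -sqrtr_sqr -[X in X * _ <= _](ger0_norm (ltW g0)).
  by rewrite -sqrtr_sqr -sqrtrM ?sqr_ge0// ler_wsqrtr.
rewrite -!mulrA ler_pdivlMl//; apply: (le_trans rc); apply: (le_trans cA).
by rewrite ler_wpM2l// /A; lra.
Qed.
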